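(* Let $q\geq 3$, $d>0$ and $c>1$. Then $$\chi(T_q,[d,cd])\leq (q-1)^{\lfloor \frac{cd}{2}+1\rfloor}\left(\lfloor cd\rfloor+1\right).$$
   Context: $T_q$ is the infinite $q$-regular tree, viewed as a metric space on its vertex set where each edge has length $1$ (combinatorial graph distance). $\chi(T_q,[d,cd])$ denotes the minimal number of colors needed to color the vertices of $T_q$ so that any two vertices whose distance lies in the interval $[d,cd]$ receive different colors. *)

(* Defs.v *)
From HB Require Import structures.
From mathcomp Require Export all_boot all_order all_algebra.
From mathcomp Require Export all_classical all_reals all_analysis.

Set Implicit Arguments.
Unset Strict Implicit.
Unset Printing Implicit Defensive.

Import Order.TTheory GRing.Theory Num.Theory.

Local Open Scope classical_set_scope.
Local Open Scope ring_scope.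

Definition simple_graph (V : choiceType) (e : rel V) : Prop :=
  symmetric e /\ irreflexive e.

Definition graph_connected (V : choiceType) (e : rel V) : Prop :=
  forall x y : V, exists2 p : seq V, path e x p & last x p = y.

(* The bound 3 discards [::] and, for an edge xy, the degenerate closed walk
   [:: x; y], which ucycle accepts. *)
Definition graph_acyclic (V : choiceType) (e : rel V) : Prop :=
  forall p : seq V, ucycle e p -> (size p < 3)%N.

Definition regular_graph (V : choiceType) (e : rel V) (q : nat) : Prop :=
  forall x : V, ([set y | e x y] #= `I_q)%card.

(* For q >= 2 such a graph is unique up to isomorphism: it is T_q. *)
Definition infinite_regular_tree (V : choiceType) (e : rel V) (q : nat) : Prop :=
  [/\ simple_graph e, graph_connected e, graph_acyclic e,
      regular_graph e q & infinite_set [set: V]].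

(* Only meaningful for connected graphs: the infimum of the empty set is 0. *)
Definition graph_dist (R : realType) (V : choiceType) (e : rel V) (x y : V) : R :=
  inf [set (size p)%:R | p in [set p : seq V | path e x p /\ last x p = y]].

Definition dist_colorable (R : realType) (X : Type) (dist : X -> X -> R)
    (D : set R) (n : nat) : Prop :=
  exists f : X -> 'I_n, forall x y : X, D (dist x y) -> f x <> f y.

(* The value is +oo exactly when no finite number of colors suffices;
   otherwise the infimum, over a nonempty set of naturals, is a minimum. *)
Definition chromatic_number (R : realType) (X : Type) (dist : X -> X -> R)
    (D : set R) : \bar R :=
  ereal_inf [set n%:R%:E | n in [set n : nat | dist_colorable dist D n]].

(* Main.v *)
Require Import Defs.
From mathcomp Require Import all_boot all_order all_algebra.
From mathcomp Require Import all_classical all_reals all_analysis.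
From mathcomp Require Import zify lra.

Import Order.TTheory GRing.Theory Num.Theory.

Local Open Scope classical_set_scope.
Local Open Scope ring_scope.

(** Root the tree and let n be the integer part of cd. A vertex is coloured by
    its level modulo n+1, together with the labels of the last n/2 edges on the
    path leading to it from the root, where edges going down from the same
    vertex have distinct labels. Two vertices with the same colour at distance
    at most n have the same level, so they meet after going up at most n/2
    steps, and the labels then force them to be equal. Every vertex but the root
    has q-1 children; the additional child of the root costs at most one more
    factor q-1, because q <= (q-1)^2. *)

(** * Rooting the tree *)

(** The value of [parent] at the root is left free. The last field is the form in which acyclicity
    enters the colouring. *)
Record rooting {V : choiceType} (e : rel V) (root : V) (level : V -> nat)
    (parent : V -> V) : Prop := Rooting {
  level_eq0 : forall x, (level x == 0)%N = (x == root);
  parent_adj : forall x, x != root -> e x (parent x);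
  level_parent : forall x, x != root -> level x = (level (parent x)).+1;
  adj_parent : forall x y, e x y ->
    (x != root /\ y = parent x) \/ (y != root /\ x = parent y) }.
Arguments level_eq0 {V e root level parent} _.
Arguments parent_adj {V e root level parent} _.
Arguments level_parent {V e root level parent} _.
Arguments adj_parent {V e root level parent} _.

Definition del_edge {V : choiceType} (e : rel V) (x y : V) : rel V :=
  fun a b => e a b && ~~ ((a == x) && (b == y) || (a == y) && (b == x)).

(** Such a walk ending at [y] would shorten to a simple path, which the edge [e x y] closes to a
    cycle. Having at most two vertices, this cycle would use a loop or the deleted edge. *)
Lemma acyclic_bridge {V : choiceType} {e : rel V} (x y : V) (p : seq V) :
  simple_graph e -> graph_acyclic e -> e x y ->
  path (del_edge e x y) x p -> last x p != y.
Proof.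
move=> [symE eirr] eac exy pp; apply/eqP; case/shortenP: pp => s sp us _ sy.
have: ucycle e (x :: s).
  apply/andP; split => //=; rewrite rcons_path sy symE exy andbT.
  by apply: sub_path sp => a b /andP[].
move/eac; case: s sp us sy => [|a [|b s]] //=.
  by move=> _ _ xy; rewrite xy eirr in exy.
by move=> xa _ ay; move: xa; rewrite ay /del_edge !eqxx andbF.
Qed.

(** The level is the distance to [r], and the parent is the last vertex but one on a shortest walk
    from [r]. *)
Lemma rooting_exists {V : choiceType} {e : rel V} (r : V) :
  simple_graph e -> graph_connected e -> graph_acyclic e ->
  exists (level : V -> nat) (parent : V -> V), rooting e r level parent.
Proof.
move=> esg econ eac; have [symE eirr] := esg.
pose reach x n := `[< exists p, [/\ path e r p, last r p = x & size p = n] >].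
have reachex x : exists n, reach x n.
  by have [p pp lp] := econ r x; exists (size p); apply/asboolP; exists p.
pose level x := ex_minn (reachex x).
have levelP x : exists p, [/\ path e r p, last r p = x & size p = level x].
  by rewrite /level; case: ex_minnP => m /asboolP.
have level_min x p : path e r p -> last r p = x -> (level x <= size p)%N.
  move=> pp lp; rewrite /level; case: ex_minnP => m _; apply.
  by apply/asboolP; exists p.
have lev0 x : (level x == 0)%N = (x == r).
  apply/eqP/eqP => [lx0|->].
    by have [p []] := levelP x; rewrite lx0 => _ <- /size0nil ->.
  by apply/eqP; rewrite -leqn0; exact: (level_min r [::]).
have par_ex x : exists z, x != r -> e x z /\ level x = (level z).+1.
  have [->|xr] := eqVneq x r; first by exists r.
  have [p []] := levelP x; case/lastP: p => [_ /= rx|p y].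
    by rewrite rx eqxx in xr.
  rewrite rcons_path last_rcons size_rcons => /andP[pp epy] yx sz.
  subst y; exists (last r p) => _; split; first by rewrite symE.
  apply/eqP; rewrite eqn_leq; apply/andP; split; last first.
    by rewrite -sz ltnS; exact: level_min.
  have [s [sp sl <-]] := levelP (last r p).
  rewrite -(size_rcons s x); apply: level_min; last by rewrite last_rcons.
  by rewrite rcons_path sp sl.
have [parent parP] := choice par_ex.
exists level, parent; split => // [x /parP[]//|x /parP[]//|x y exy].
apply: contrapT => /not_orP[Nx Ny].
(* If the edge [x y] joins no vertex to its parent, then no chain of parents uses it. The chains
   from [x] and [y] to [r] together form a detour, against [acyclic_bridge]. *)
have up z : exists2 p, path (del_edge e x y) z p & last z p = r.
  have [n] := ubnP (level z); elim: n z => // n IH z zn.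
  have [->|zr] := eqVneq z r; first by exists [::].
  have [ez lz] := parP z zr.
  have [|p pp lp] := IH (parent z); first by rewrite lz in zn.
  exists (parent z :: p) => //=; rewrite pp andbT /del_edge ez /=.
  apply/negP => /orP[/andP[/eqP zx /eqP zy]|/andP[/eqP zy /eqP zx]].
    by apply: Nx; rewrite -zy -zx.
  by apply: Ny; rewrite -zx -zy.
have dsym : symmetric (del_edge e x y).
  by move=> a b; rewrite /del_edge symE orbC ![(_ == x) && _]andbC.
have [p pp lp] := up x; have [s sp sl] := up y.
have := acyclic_bridge x y (p ++ rev (belast y s)) esg eac exy.
have -> : last x (p ++ rev (belast y s)) = y.
  rewrite last_cat lp; case: s sp sl => [|a s] //= _ _.
  by rewrite rev_cons last_rcons.
rewrite eqxx => /(_ _)/notF; apply.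
rewrite cat_path pp lp -sl rev_path.
by rewrite (eq_path (e' := del_edge e x y)) // => a b; rewrite dsym.
Qed.

(** Induction on the walk. A first step up adds one to [i]; a first step down cancels the first of
    the [i] steps up from [x'], or adds one to [j] when [i] is 0. *)
Lemma walk_common_ancestor {V : choiceType} {e : rel V} (r : V)
    (level : V -> nat) (parent : V -> V) (x : V) (p : seq V) :
  rooting e r level parent -> path e x p ->
  exists i j, [/\ (i + j <= size p)%N, (i + level (last x p) = j + level x)%N
    & iter i parent x = iter j parent (last x p)].
Proof.
move=> rt; elim: p x => [|x' p IH] x /=; first by exists 0%N, 0%N.
case/andP=> exx' /IH[i [j [ij lij eij]]].
case: (adj_parent rt _ _ exx') => [[xr x'E]|[x'r xE]].
  have lx := level_parent rt _ xr; rewrite -x'E in lx.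
  by exists i.+1, j; split; [lia|lia|rewrite iterSr -x'E].
have lx := level_parent rt _ x'r; rewrite -xE in lx.
case: i ij lij eij => [|i] ij lij eij.
  by exists 0%N, j.+1; split; [lia|lia|rewrite iterS -eij].
by exists i, j; split; [lia|lia|rewrite -eij iterSr -xE].
Qed.

(** * Edge labels and path codes *)

Lemma neighbour_label {V : choiceType} {e : rel V} (q : nat) :
  regular_graph e q -> exists g : V -> V -> nat, forall x,
    (forall y, e x y -> (g x y < q)%N) /\
    (forall y z, e x y -> e x z -> g x y = g x z -> y = z).
Proof.
move=> ereg.
suff /choice[g gP] : forall x, exists h : V -> nat,
    (forall y, e x y -> (h y < q)%N) /\
    (forall y z, e x y -> e x z -> h y = h z -> y = z) by exists g.
move=> x; have /card_set_bijP[f [fI finj _]] := ereg x.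
exists f; split => [y exy|y z exy exz fyz]; first exact: fI.
by apply: finj => //; rewrite inE.
Qed.

Lemma child_label {V : choiceType} {e : rel V} (q : nat) (r : V)
    (level : V -> nat) (parent : V -> V) :
  simple_graph e -> regular_graph e q -> rooting e r level parent ->
  exists l : V -> nat,
  [/\ forall x, x != r -> (l x < q)%N,
      forall x, x != r -> parent x != r -> (l x < q.-1)%N
    & forall x y, x != r -> y != r -> parent x = parent y -> l x = l y ->
        x = y].
Proof.
move=> [symE _] ereg rt; have [g gP] := neighbour_label q ereg.
have padj := parent_adj rt.
have chadj x : x != r -> e (parent x) x by move=> ?; rewrite symE padj.
have ppN x : x != r -> parent x != r -> parent (parent x) <> x.
  move=> xr pxr ppx; have := level_parent rt _ xr.
  by have := level_parent rt _ pxr; rewrite ppx; lia.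
have gne x : x != r -> parent x != r ->
    g (parent x) x <> g (parent x) (parent (parent x)).
  move=> xr pxr /(proj2 (gP _) _ _ (chadj _ xr) (padj _ pxr)) /esym.
  exact: ppN.
(* The label q-1 is exchanged with the label of the grandparent, which is not a
   child of the parent. *)
exists (fun x => let z := parent x in
  if (z != r) && (g z x == q.-1) then g z (parent z) else g z x).
split => /= [x xr|x xr pxr|x y xr yr pxy].
- have gx := proj1 (gP _) _ (chadj _ xr).
  by case: ifP => // /andP[pxr _]; exact: (proj1 (gP _) _ (padj _ pxr)).
- have gx := proj1 (gP _) _ (chadj _ xr).
  have gpx := proj1 (gP _) _ (padj _ pxr).
  have := gne _ xr pxr.
  by rewrite pxr /=; case: eqP => ? ?; lia.
- have gy := chadj _ yr; have gx := chadj _ xr; rewrite -pxy in gy *.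
  have gny := gne _ yr; rewrite -pxy in gny; have gnx := gne _ xr.
  have ginj := proj2 (gP _) _ _ gx gy.
  have [pxr|pxr] := boolP (parent x != r); rewrite /=; last exact: ginj.
  (* If just one of the two labels was exchanged, the other child would share the label of the
     grandparent. *)
  case: eqP => hx; case: eqP => hy h; apply: ginj => //.
  + by rewrite hx hy.
  + by case: (gny pxr).
  + by case: (gnx pxr).
Qed.

(** An expansion in base q-1 whose lowest digit belongs to the edge nearest to [x]. A child of the
    root may carry the excess digit q-1, but only in leading position. *)
Fixpoint path_code {V : choiceType} (q : nat) (r : V) (parent : V -> V)
    (l : V -> nat) (k : nat) (x : V) : nat :=
  if k is k'.+1 then
    if x == r then 0%N
    else (l x + q.-1 * path_code q r parent l k' (parent x))%N
  else 0%N.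

Lemma path_code_root {V : choiceType} (q : nat) (r : V) (parent : V -> V)
    (l : V -> nat) (k : nat) : path_code q r parent l k r = 0%N.
Proof. by case: k => //= k; rewrite eqxx. Qed.

Lemma path_code_bound {V : choiceType} (q : nat) (r : V) (parent : V -> V)
    (l : V -> nat) (k : nat) (x : V) : (3 <= q)%N ->
  (forall x, x != r -> (l x < q)%N) ->
  (forall x, x != r -> parent x != r -> (l x < q.-1)%N) ->
  (path_code q r parent l k x < q.-1 ^ k.+1)%N.
Proof.
move=> q3 lq lq1; elim: k x => [|k IH] x /=; first by rewrite expn1; lia.
have [_|xr] := eqVneq x r; first by rewrite expn_gt0; lia.
have [pxr|pxr] := eqVneq (parent x) r.
  (* The excess digit: here q <= (q-1)^2 is used, which is why the exponent is [k.+1] and not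
     [k]. *)
  rewrite pxr path_code_root muln0 addn0.
  apply: leq_trans (lq _ xr) _; rewrite !expnS mulnA.
  have : (0 < q.-1 ^ k)%N by rewrite expn_gt0; lia.
  by nia.
have := IH (parent x); have := lq1 _ xr pxr.
by rewrite [in X in (_ -> _ -> X)%N]expnS; nia.
Qed.

(** Vertices of equal level reach the root simultaneously, so their digits can be compared one by
    one, and [k] digits cover the [i] steps to the common ancestor. *)
Lemma path_code_inj {V : choiceType} {e : rel V} (q : nat) (r : V)
    (level : V -> nat) (parent : V -> V) (l : V -> nat) (i k : nat) (x y : V) :
  rooting e r level parent ->
  (forall x, x != r -> parent x != r -> (l x < q.-1)%N) ->
  (forall x y, x != r -> y != r -> parent x = parent y -> l x = l y -> x = y) ->
  (i <= k)%N -> level x = level y -> iter i parent x = iter i parent y ->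
  path_code q r parent l k x = path_code q r parent l k y -> x = y.
Proof.
move=> rt lq1 linj; elim: i k x y => [//|i IH] [//|k] x y ik lxy.
rewrite !iterSr => ixy /=.
have rxy : (x == r) = (y == r) by rewrite -!(level_eq0 rt) lxy.
rewrite -rxy; have [xr|xr] := eqVneq x r.
  by move: rxy; rewrite xr eqxx => /esym/eqP.
have yr : y != r by rewrite -rxy.
have lpxy : level (parent x) = level (parent y).
  have := level_parent rt _ xr.
  by have := level_parent rt _ yr; lia.
have rpxy : (parent x == r) = (parent y == r).
  by rewrite -!(level_eq0 rt) lpxy.
(* Below the root the code is the label itself, so the excess digit needs no reduction modulo
   q-1. *)
have [pxr|pxr] := eqVneq (parent x) r.
  have pyr : parent y = r by apply/eqP; rewrite -rpxy pxr.
  rewrite pxr pyr path_code_root => /addIn; apply: linj => //.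
  by rewrite pxr pyr.
have pyr : parent y != r by rewrite -rpxy.
move=> code_eq.
have lxq := lq1 _ xr pxr; have lyq := lq1 _ yr pyr.
have lxlye : l x = l y.
  have := congr1 (modn^~ q.-1) code_eq.
  by rewrite /= ![(_ + q.-1 * _)%N]addnC ![(q.-1 * _)%N]mulnC !modnMDl !modn_small.
apply: linj => //; apply: (IH k) => //.
move: code_eq; rewrite lxlye => /addnI/eqP.
by rewrite eqn_pmul2l; [move/eqP|lia].
Qed.

(** * The colouring *)

Lemma walk_colouring {V : choiceType} {e : rel V} (q n : nat) (r : V) :
  (3 <= q)%N -> simple_graph e -> graph_connected e -> graph_acyclic e ->
  regular_graph e q ->
  exists f : V -> 'I_(q.-1 ^ n./2.+1 * n.+1), forall x p,
    path e x p -> (size p <= n)%N -> f x = f (last x p) -> x = last x p.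
Proof.
move=> q3 esg econ eac ereg.
have [level [parent rt]] := rooting_exists r esg econ eac.
have [l [lq lq1 linj]] := child_label q r level parent esg ereg rt.
pose code := path_code q r parent l n./2.
have fP x : (code x * n.+1 + level x %% n.+1 < q.-1 ^ n./2.+1 * n.+1)%N.
  have := path_code_bound q r parent l n./2 x q3 lq lq1.
  have := ltn_pmod (level x) (ltn0Sn n); rewrite -/(code x).
  by set u := (_ ^ _)%N; set v := (_ %% _)%N; nia.
exists (fun x => Ordinal (fP x)) => x p xp pn /(congr1 val) /= fxy.
have [i [j [ij lij aij]]] := walk_common_ancestor r level parent x p rt xp.
set y := last x p in fxy lij aij *.
have lmod : (level x = level y %[mod n.+1])%N.
  by have := congr1 (modn^~ n.+1) fxy; rewrite /= !modnMDl !modn_mod.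
have cxy : code x = code y.
  by move: fxy; rewrite lmod => /addIn/eqP; rewrite eqn_pmul2r // => /eqP.
(* The levels differ by at most [i + j <= n] and agree modulo [n.+1]. *)
have lxy : level x = level y.
  rewrite (divn_eq (level x) n.+1) (divn_eq (level y) n.+1) lmod in lij *.
  by congr (_ * _ + _)%N; move: lij; set a := (_ %/ _)%N; set b := (_ %/ _)%N; nia.
have eij : i = j by lia.
subst j.
apply: (path_code_inj q r level parent l i n./2 x y rt lq1 linj _ lxy aij cxy).
by rewrite geq_half_double -addnn (leq_trans ij pn).
Qed.

(** * Graph distance and the bound *)

Lemma graph_distxx (R : realType) (V : choiceType) (e : rel V) (x : V) :
  graph_dist R e x x = 0.
Proof.
have x0 : [set (size p)%:R | p in [set p | path e x p /\ last x p = x]] (0 : R).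
  by exists [::].
have lb0 : lbound
    [set (size p)%:R | p in [set p | path e x p /\ last x p = x]] (0 : R).
  by move=> _ [p _ <-]; rewrite ler0n.
apply/eqP; rewrite eq_le; apply/andP; split.
  by apply: ge_inf x0; exists 0.
by apply: lb_le_inf lb0; exists 0.
Qed.

(** An element of the set lies below any strict upper bound of its infimum, so attainment need not
    be shown. *)
Lemma graph_dist_walk {R : realType} {V : choiceType} {e : rel V} (x y : V)
    (n : nat) : graph_connected e -> graph_dist R e x y < n.+1%:R ->
  exists p, [/\ path e x p, last x p = y & (size p <= n)%N].
Proof.
move=> econ; rewrite /graph_dist; set S := (X in inf X) => dn.
have S0 : S !=set0.
  by have [p pp lp] := econ x y; exists (size p)%:R; exists p.
have [_ [p [pp lp] <-]] := inf_lt S0 dn.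
by rewrite ltr_nat ltnS => pn; exists p.
Qed.

Theorem mainTheorem14 (R : realType) (q : nat) (hq : (3 <= q)%N)
    (V : choiceType) (e : rel V) (hT : infinite_regular_tree e q)
    (d c : R) (hd : 0 < d) (hc : 1 < c) :
  (chromatic_number (graph_dist R e) `[d, (c * d)%R]
   <= ((q%:R - 1) ^ Num.floor (c * d / 2 + 1)
       * ((Num.floor (c * d))%:~R + 1))%:E)%E.
Proof.
have [esg econ eac ereg Vinf] := hT; have [r _] := infinite_setN0 Vinf.
have cd0 : 0 <= c * d by rewrite mulr_ge0 ?ltW // (lt_trans ltr01).
have [n nE] : exists n : nat, Num.floor (c * d) = n%:Z.
  have : 0 <= Num.floor (c * d) by rewrite floor_ge0.
  by case: (Num.floor _) => // m _; exists m.
have [ncd cdn] : n%:R <= c * d /\ c * d < n.+1%:R.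
  have /andP := floor_itv (c * d); rewrite nE => -[h1 h2]; split => //.
  by move: h2; rewrite intrD -natr1.
(* From [n <= c * d < n + 1] and the parity of [n], the floors of [c * d / 2] and [n / 2]
   coincide. *)
have -> : Num.floor (c * d / 2 + 1) = n./2.+1%:Z.
  apply: floor_def; rewrite intrD /= -!pmulrn.
  have n2 : n%:R = (odd n)%:R + 2 * n./2%:R :> R.
    by rewrite -natrM -natrD mul2n odd_double_half.
  have n1 : (odd n)%:R <= 1 :> R by rewrite lern1; case: odd.
  have n0 : 0 <= (odd n)%:R :> R by rewrite ler0n.
  rewrite -natr1 in cdn; rewrite -[n./2.+1%:R]natr1; apply/andP; split; lra.
rewrite nE -exprnP -pmulrn natr1 -[X in _ - X]/(1%:R) -natrB; last by lia.
rewrite subn1 -natrX -natrM.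
apply: ereal_inf_lbound; exists (q.-1 ^ n./2.+1 * n.+1)%N => //=.
have [f fP] := walk_colouring q n r hq esg econ eac ereg.
exists f => x y /=; rewrite in_itv /= => /andP[dxy xycd] fxy.
have [p [pp lp pn]] := graph_dist_walk x y n econ (le_lt_trans xycd cdn).
have xy : x = y by rewrite -lp; apply: fP => //; rewrite lp.
(* Equal vertices have distance 0, which is less than [d]. *)
by move: dxy; rewrite xy graph_distxx leNgt hd.
Qed.
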